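(* Let $v$ be a positive integer and let $\mathcal{D}$ be a binary $q$-Steiner triple system $S_2[2,3,v]$, i.e. a set of $3$-dimensional subspaces of $\mathbb{F}_2^v$ such that every $2$-dimensional subspace of $\mathbb{F}_2^v$ is contained in exactly one member of $\mathcal{D}$. Let $A\in\mathrm{GL}(v,2)$ be (the matrix of) an automorphism of $\mathcal{D}$ of order $2$. For $s\in\{1,\ldots,\lfloor v/2\rfloor\}$ let $A_{v,s}$ denote the $v\times v$ block diagonal matrix built from $s$ blocks $\begin{pmatrix}0&1\\1&0\end{pmatrix}$ followed by a $(v-2s)\times(v-2s)$ identity matrix. (a) If $v\equiv 1\pmod 6$, then $A$ is conjugate in $\mathrm{GL}(v,2)$ to a matrix $A_{v,s}$ with $3\mid s$. (b) If $v\equiv 3\pmod 6$, then $A$ is conjugate in $\mathrm{GL}(v,2)$ to a matrix $A_{v,s}$ with $s\not\equiv 2\pmod 3$.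
   Context: Vectors are row vectors; $A\in\mathrm{GL}(v,2)$ acts on subspaces by $U\mapsto UA=\{\mathbf{u}A:\mathbf{u}\in U\}$ and on sets of subspaces elementwise. $A$ is an automorphism of $\mathcal{D}$ if $\{BA: B\in\mathcal{D}\}=\mathcal{D}$. *)

(* Defs.v *)
From HB Require Import structures.
From mathcomp Require Import all_boot all_order all_algebra all_fingroup all_field.

Set Implicit Arguments.
Unset Strict Implicit.
Unset Printing Implicit Defensive.

Import GRing.Theory VectorInternalTheory.
Local Open Scope ring_scope.

(* The library gives {vspace vT} only a choiceType structure; over a finite
   field it is finite, as a subtype of the type of square matrices. *)
HB.instance Definition _ (K : finFieldType) (vT : vectType K) :=
  [Countable of {vspace vT} by <:].
HB.instance Definition _ (K : finFieldType) (vT : vectType K) :=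
  [Finite of {vspace vT} by <:].

Definition is_q_steiner_triple_system (v : nat)
    (D : {set {vspace 'rV['F_2]_v}}) : Prop :=
  (forall B, B \in D -> \dim B = 3) /\
  (forall T : {vspace 'rV['F_2]_v}, \dim T = 2 ->
     exists! B : {vspace 'rV['F_2]_v}, B \in D /\ (T <= B)%VS).

Definition subspace_mulmx (v : nat) (A : 'M['F_2]_v)
    (U : {vspace 'rV['F_2]_v}) : {vspace 'rV['F_2]_v} :=
  (linfun (mulmxr A) @: U)%VS.

Definition is_automorphism (v : nat) (D : {set {vspace 'rV['F_2]_v}})
    (A : 'M['F_2]_v) : Prop :=
  [set subspace_mulmx A B | B in D] = D.

Definition swap_mx : 'M['F_2]_2 := \matrix_(i, j) (i != j)%:R.

(* Meaningful for 2 * s <= v: the s swap blocks are peeled off from the top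
   left corner, and the remaining v - 2 * s coordinates carry the identity. *)
Fixpoint swap_block_mx (v s : nat) : 'M['F_2]_v :=
  match s, v with
  | s'.+1, v'.+2 =>
      block_mx swap_mx 0 0 (swap_block_mx v' s') : 'M['F_2]_(2 + v')
  | _, _ => 1%:M
  end.

(* Main.v *)
Require Import Defs.
From HB Require Import structures.
From mathcomp Require Import all_boot all_order all_algebra all_fingroup all_field.
From mathcomp Require Import zify.

(** Put N = A - 1, so that N^2 = 0; by a normal form argument A is conjugate to
    A_{v,s} with s the rank of N, hence A fixes x = 2^(v-s) vectors.  A vector u
    with uA <> u lies in exactly one fixed block, namely the block through u and
    uA; two distinct nonzero fixed vectors lie in exactly one block, and that
    block is fixed.  As N^2 = 0, a fixed block contains 4 or 8 fixed vectors.
    Counting the moved vectors and the pairs of fixed vectors block by block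
    gives 3 (2^v - x) = 2 (x - 1)(x - 2) modulo 7, which only depends on the
    residues of v and s modulo 3. *)

Set Implicit Arguments.
Unset Strict Implicit.
Unset Printing Implicit Defensive.

Import GRing.Theory.

Lemma F2_neq0 (x : 'F_2) : (x != 0 -> x = 1)%R.
Proof. by case: x => [[|[|m]] hm] // _; apply/val_inj. Qed.

(** * Normal form of involutory matrices over the field with two elements *)

Section NormalForm.
Local Open Scope ring_scope.

Lemma swap_mx_block : swap_mx = block_mx 0 1%:M 1%:M 0 :> 'M_(1 + 1).
Proof.
apply/matrixP=> i j; rewrite !mxE -val_eqE /=.
by case: splitP => i' ->; rewrite !mxE; case: splitP => j' ->;
  rewrite !ord1 !mxE.
Qed.

Lemma mul_swap_col_mx v (x y : 'rV['F_2]_v) :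
  swap_mx *m (col_mx x y : 'M_(1 + 1, v)) = col_mx y x.
Proof.
rewrite swap_mx_block; apply: etrans (@mul_block_col _ 1 1 1 1 v _ _ _ _ x y) _.
by rewrite !mul0mx !mul1mx add0r addr0.
Qed.

Lemma mul_row_mx_swap v (x y : 'cV['F_2]_v) :
  (row_mx x y : 'M_(v, 1 + 1)) *m swap_mx = row_mx y x.
Proof.
rewrite swap_mx_block; apply: etrans (@mul_row_block _ v 1 1 1 1 x y _ _ _ _) _.
by rewrite !mulmx0 !mulmx1 add0r addr0.
Qed.

Lemma swap_block_mx0 v : swap_block_mx v 0 = 1%:M.
Proof. by case: v. Qed.

(** This provides one swap block. A nonzero entry of [M - 1%:M] yields [u] and [c] with
    [u *m (M - 1%:M) *m c = 1%:M]; take [u], [u *m M] as rows of [R] and [c], [M *m c] as columns of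
    [C]. *)
Lemma involution_swapped_pair v (M : 'M['F_2]_v) :
    M *m M = 1%:M -> M != 1%:M ->
  exists (R : 'M_(2, v)) (C : 'M_(v, 2)),
    [/\ R *m M = swap_mx *m R, M *m C = C *m swap_mx & R *m C \in unitmx].
Proof.
move=> MM; rewrite -subr_eq0 => /matrix0Pn[i [j Nij]].
pose u : 'rV['F_2]_v := delta_mx 0 i; pose c : 'cV['F_2]_v := delta_mx j 0.
have uNc : u *m (M - 1%:M) *m c = 1%:M.
  rewrite -rowE; apply/matrixP=> a b; rewrite !ord1 -colE !mxE.
  by move: Nij; rewrite !mxE => /F2_neq0.
exists (col_mx u (u *m M)), (row_mx c (M *m c)); split.
- by rewrite mul_swap_col_mx (@mul_col_mx _ 1 1) -mulmxA MM mulmx1.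
- by rewrite mul_row_mx_swap (@mul_mx_row _ _ _ 1 1) mulmxA MM mul1mx.
rewrite (@mul_col_row _ 1 1 _ 1 1) -!mulmxA [M *m (M *m c)]mulmxA MM mul1mx.
move: uNc; rewrite -mulmxA mulmxBl mul1mx mulmxBr.
rewrite [u *m c]mx11_scalar [u *m (M *m c)]mx11_scalar.
move: (_ 0 0) (_ 0 0) => a b /matrixP/(_ 0 0); rewrite !mxE /= => ab.
(* [R *m C] has rows [(a, b)] and [(b, a)], where exactly one of [a], [b] is 1, so it is its own
   inverse. *)
have [aabb abba] : a * a + b * b = 1 /\ a * b + b * a = 0.
  by split; apply/val_inj; move: ab => /(congr1 val);
    case: a => [[|[|a]] ha] //; case: b => [[|[|b]] hb].
suff inv : block_mx a%:M b%:M b%:M a%:M *m block_mx a%:M b%:M b%:M a%:M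
    = 1%:M :> 'M_(1 + 1) by case: (mulmx1_unit inv).
rewrite mulmx_block -!scalar_mxM -!raddfD /= scalar_mx_block.
by rewrite [b * a + _]addrC [b * b + _]addrC aabb abba raddf0.
Qed.

(** Naming the rank [r] gives the basis a prescribed number of rows in its type, without casts. *)
Lemma row_base_rank_eq (F : fieldType) m n r (B : 'M[F]_(m, n)) : \rank B = r ->
  exists2 K : 'M_(r, n), row_free K & (K :=: B)%MS.
Proof.
move=> <-; exists (row_base B); [exact: row_base_free | exact: eq_row_base].
Qed.

Lemma involution_normal_form v (M : 'M['F_2]_v) : M *m M = 1%:M ->
  exists s, (s <= v %/ 2)%N /\
  exists2 Q : 'M_v, Q \in unitmx & Q *m M = swap_block_mx v s *m Q.
Proof.
elim/ltn_ind: v M => v IH M MM.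
have [->|M1] := eqVneq M 1%:M.
  exists 0%N; split=> //; exists 1%:M; first exact: unitmx1.
  by rewrite swap_block_mx0.
(* The row space of [R] and the kernel of [C] are complementary and both
   stable under [M]. *)
have [R [C [RM MC RCu]]] := involution_swapped_pair MM M1.
have rkC : \rank C = 2%N.
  apply/eqP; rewrite eqn_leq rank_leq_col.
  by rewrite -{1}(mxrank_unit RCu) mxrankM_maxr.
have : (2 <= v)%N by rewrite -rkC rank_leq_row.
case: v => [|[|n]] // in IH M MM M1 R C RM MC RCu rkC * => _.
have [|K Kfree Kker] := @row_base_rank_eq _ _ _ n (kermx C).
  by rewrite mxrank_ker rkC subn2.
have KC : K *m C = 0 by apply/sub_kermxP; rewrite Kker.
have /submxP[M' KM] : (K *m M <= K)%MS.
  by rewrite Kker; apply/sub_kermxP; rewrite -mulmxA MC mulmxA KC mul0mx.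
(* [M'] represents [M] on the kernel of [C] in the basis [K], so it is again an involution. *)
have [|s [le_s [Q Qu QM]]] := IH n (leqnSn _) M'.
  apply: (row_free_inj Kfree).
  by rewrite -mulmxA -KM mulmxA -KM -mulmxA MM mulmx1 mul1mx.
exists s.+1; split; first by rewrite -[n.+2]addn2 divnDr // divnn addn1.
exists (col_mx R (Q *m K) : 'M_(2 + n)).
  (* Multiplying a linear relation between the rows by [C] removes the [K] part; invertibility of
     [R *m C] then kills the coefficients of [R], and freeness of [K] and [Q] kills the others. *)
  rewrite -row_free_unit -kermx_eq0 -submx0; apply/row_subP=> i; rewrite submx0.
  set x := row i _; have : x *m col_mx R (Q *m K) = 0.
    by apply/sub_kermxP; rewrite row_sub.
  rewrite -[x](@hsubmxK _ 1 2 n) (@mul_row_col _ 1 2 n) => xR.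
  have x1 : lsubmx (x : 'rV_(2 + n)) = 0.
    move/(congr1 (mulmx^~ C)): xR.
    rewrite mulmxDl mul0mx -!mulmxA KC !mulmx0 addr0.
    by move/eqP; rewrite mulmx_free_eq0 ?row_free_unit // => /eqP.
  move: xR; rewrite x1 mul0mx add0r mulmxA => /eqP.
  rewrite mulmx_free_eq0 // mulmx_free_eq0 ?row_free_unit // => /eqP->.
  by rewrite row_mx0.
rewrite [swap_block_mx _ _]/= (@mul_block_col _ 2 n 2 n) !mul0mx addr0 add0r.
by rewrite (@mul_col_mx _ 2 n) RM -mulmxA KM !mulmxA QM.
Qed.

(** Since -1 = 1, each swap block minus the identity is the all-ones matrix, of rank one. This
    identifies [s] with a conjugation invariant. *)
Lemma rank_swap_block_mx v s : (s <= v %/ 2)%N ->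
  \rank (swap_block_mx v s - 1%:M) = s.
Proof.
elim: s v => [|s IH] v; first by rewrite swap_block_mx0 subrr mxrank0.
case: v => [|[|v]] // le_s; rewrite [swap_block_mx _ _]/=.
rewrite (@scalar_mx_block _ 2 v) (@opp_block_mx _ 2 v 2 v).
rewrite (@add_block_mx _ 2 v 2 v) !oppr0 !addr0.
rewrite (@rank_diag_block_mx _ 2 2 v v) IH; last by move: le_s; lia.
have c_neq0 : const_mx 1 != 0 :> 'rV['F_2]_2.
  by apply/rV0Pn; exists 0; rewrite mxE.
suff -> : swap_mx - 1%:M = (const_mx 1 : 'cV_2) *m (const_mx 1 : 'rV_2).
  rewrite mxrankMfree; first by rewrite -mxrank_tr trmx_const rank_rV c_neq0.
  by rewrite /row_free rank_rV c_neq0.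
apply/matrixP=> i j; rewrite !mxE big_ord1 !mxE.
by case: eqP => _; apply/val_inj.
Qed.

End NormalForm.

Lemma oppmxF2 m n (M : 'M['F_2]_(m, n)) : (- M = M)%R.
Proof.
apply/matrixP=> i j; rewrite mxE; apply/val_inj.
by case: (M i j) => [[|[|k]] hk].
Qed.

Lemma card_double_count (T I : finType) (S : {set T}) (J : {set I})
    (r : I -> T -> bool) :
  (forall x, x \in S -> exists! i, i \in J /\ r i x) ->
  #|S| = \sum_(i in J) #|[set x in S | r i x]|.
Proof.
move=> uniqJ.
under eq_bigr => i _ do rewrite -sum1_card.
rewrite -sum1_card (exchange_big_dep (mem S)) /=; last first.
  by move=> i x _; rewrite inE => /andP[].
apply: eq_bigr => x xS; have [i [[iJ rix] i_uniq]] := uniqJ x xS.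
rewrite sum1dep_card -(cards1 i); congr #|pred_of_set _|; apply/setP=> j.
rewrite !inE xS /=.
by apply/eqP/andP=> [->|[jJ rjx]] //; apply/esym/i_uniq.
Qed.

(** * Blocks fixed by an involution, and the two counts over them *)

Section Subspaces.
Variable v : nat.
Local Notation V := 'rV['F_2]_v.
Implicit Types (U W : {vspace V}) (x y : V).

Lemma card_vspaceF2 W : #|W| = (2 ^ \dim W)%N.
Proof. by rewrite card_vspace card_ord. Qed.

(** Over F_2 these are the ordered bases of the 2-dimensional subspaces of [W]. *)
Definition line_pairs W : {set V * V} :=
  [set p : V * V | [&& p.1 \in W, p.1 != 0%R, p.2 \in W, p.2 != 0%R
                     & p.1 != p.2]].

Lemma card_line_pairs W : #|line_pairs W| = (#|W| - 1) * (#|W| - 2).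
Proof.
rewrite -sum1_card.
rewrite (eq_bigl (fun p : V * V => (p.1 \in W) && (p.1 != 0%R) &&
    [&& p.2 \in W, p.2 != 0%R & p.1 != p.2])); last first.
  by move=> p; rewrite inE !andbA.
rewrite -(pair_big_dep (fun x => (x \in W) && (x != 0%R))
  (fun x y => [&& y \in W, y != 0%R & x != y]) (fun _ _ => 1)) /=.
have cardD1 : #|[set x in W | x != 0%R]| = #|W| - 1.
  rewrite -[#|W|]cardsE (cardsD1 0%R [set x in W]) inE mem0v add1n subn1 /=.
  by congr #|pred_of_set _|; apply/setP=> x; rewrite !inE andbC.
rewrite (eq_bigr (fun _ => #|W| - 2)) => [|x /andP[xW x0]].
  by rewrite big_const iter_addn_0 mulnC -cardD1 cardsE.
rewrite sum1dep_card subn2 -[#|W|]cardsE.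
rewrite [in RHS](cardsD1 0%R) inE mem0v add1n /=.
rewrite [in RHS](cardsD1 x) !inE xW x0 add1n /=.
congr #|pred_of_set _|; apply/setP=> y; rewrite !inE [y == x]eq_sym.
by rewrite andbA andbC [(y \in W) && _]andbC.
Qed.

(** The only scalars are 0 and 1, so distinct nonzero vectors are independent and span a
    2-dimensional subspace. *)
Lemma steiner_block_of_pair (D : {set {vspace V}}) x y :
  is_q_steiner_triple_system D -> x != 0%R -> y != 0%R -> x != y ->
  exists! B, B \in D /\ (x \in B) && (y \in B).
Proof.
move=> [_ uniqD] x0 y0 xy.
have freexy : free [:: x; y].
  rewrite free_cons seq1_free y0 andbT span_seq1; apply/vlineP=> -[k xky].
  case: (eqVneq k 0%R) => [k0|/F2_neq0 k1].
    by case/eqP: x0; rewrite xky k0 scale0r.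
  by case/eqP: xy; rewrite xky k1 scale1r.
have sub B : (<<[:: x; y]>> <= B)%VS = (x \in B) && (y \in B).
  by rewrite span_cons span_seq1 subv_add !memvE.
have [|B [[BD TB] B_uniq]] := uniqD <<[:: x; y]>>%VS.
  exact: (eqP freexy).
exists B; split; first by rewrite -sub.
by move=> B'; rewrite -sub; apply: B_uniq.
Qed.

Section Involution.
Variables (D : {set {vspace V}}) (A : 'M['F_2]_v).
Hypothesis AA : (A *m A = 1%:M)%R.

Lemma mulmx_involutionK : cancel (fun x => x *m A)%R (fun x => x *m A)%R.
Proof. by move=> x; rewrite -mulmxA AA mulmx1. Qed.

Definition fixed_space : {vspace V} := lker (linfun (mulmxr (A - 1%:M)%R)).

Lemma mem_fixed_space x : (x \in fixed_space) = (x *m A == x)%R.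
Proof. by rewrite memv_ker lfunE /= mulmxBr mulmx1 subr_eq0. Qed.

Lemma mem_subspace_mulmx U x :
  (x *m A \in subspace_mulmx A U)%R = (x \in U).
Proof.
apply/memv_imgP/idP => [[y yU]|xU]; last by exists x; rewrite // lfunE.
by rewrite lfunE /= => /(can_inj mulmx_involutionK) ->.
Qed.

(** The kernel as a vector space and the kernel as a matrix row space are compared by cardinality,
    both being powers of 2. *)
Lemma dim_fixed_space : \dim fixed_space = (v - \rank (A - 1%:M)%R).
Proof.
set N := (A - 1%:M)%R; apply: (@expnI 2) => //; rewrite -card_vspaceF2.
rewrite -mxrank_ker; set K := kermx N.
have K_inj := row_free_inj (row_base_free K) : injective (fun x : 'rV__ => _).
have subK x : (x <= row_base K)%MS = (x <= K)%MS by rewrite eq_row_base.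
have <- : #|{: 'rV['F_2]_(\rank K)}| = 2 ^ \rank K.
  by rewrite card_mx card_ord mul1n.
rewrite -(card_imset _ K_inj); apply: eq_card => x.
rewrite mem_fixed_space -[in LHS]subr_eq0 -{2}[x]mulmx1 -mulmxBr.
apply/eqP/imsetP => [/sub_kermxP|[y _ ->]].
  by rewrite -subK => /submxP[y ->]; exists y.
by apply/sub_kermxP; rewrite -subK submxMl.
Qed.

Hypothesis steinerD : is_q_steiner_triple_system D.
Hypothesis autD : is_automorphism D A.

Definition fixed_blocks := [set B in D | subspace_mulmx A B == B].

(** The image under [A] of the block through [x] and [y] is a block that again contains both, so
    uniqueness makes it the same block. *)
Lemma fixed_block_of_pair x y :
    x != 0%R -> y != 0%R -> x != y ->
    (forall B : {vspace V}, x \in B -> y \in B ->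
       (x *m A \in B)%R /\ (y *m A \in B)%R) ->
  exists! B, B \in fixed_blocks /\ (x \in B) && (y \in B).
Proof.
move=> x0 y0 xy stab.
have [B [[BD /andP[xB yB]] B_uniq]] := steiner_block_of_pair steinerD x0 y0 xy.
exists B; split; last by move=> B' [] /[!inE] /andP[B'D _] xyB'; apply: B_uniq.
split; last by rewrite xB yB.
rewrite inE BD /=; apply/eqP/esym/B_uniq; split.
  by rewrite -autD imset_f.
have [xAB yAB] := stab B xB yB.
by rewrite -[x]mulmx_involutionK -[y]mulmx_involutionK !mem_subspace_mulmx xAB.
Qed.

(** [A - 1%:M] maps [B] into its own kernel on [B], so by rank-nullity 3 is at most twice the
    dimension of that kernel. *)
Lemma dim_fixed_block B : B \in fixed_blocks ->
  \dim B = 3 /\ (\dim (B :&: fixed_space) = 2 \/ \dim (B :&: fixed_space) = 3).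
Proof.
rewrite inE => /andP[BD /eqP BA]; have dimB := steinerD.1 B BD; split=> //.
pose f : 'End(V) := linfun (mulmxr (A - 1%:M)%R).
have := limg_ker_dim f B.
have : \dim (f @: B)%VS <= \dim (B :&: fixed_space).
  apply/dimvS/subvP => _ /memv_imgP[x xB ->]; rewrite lfunE /=.
  rewrite memv_cap mem_fixed_space mulmxBr mulmx1 rpredB //=; last first.
    by rewrite -BA mem_subspace_mulmx.
  by rewrite mulmxBl mulmx_involutionK -opprB oppmxF2.
rewrite -[lker f]/fixed_space dimB; have := dimvS (capvSl B fixed_space).
rewrite dimB; move: (\dim (_ :&: _)) (\dim (_ @: _)); lia.
Qed.

Lemma card_not_fixed :
  2 ^ v - #|fixed_space| =
  \sum_(B in fixed_blocks) (8 - #|(B :&: fixed_space)%VS|).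
Proof.
have -> : 2 ^ v - #|fixed_space| = #|~: [set x in fixed_space]|.
  by rewrite cardsCs setCK cardsE card_mx card_ord mul1n.
rewrite (@card_double_count _ _ _ fixed_blocks (fun B x => x \in B)).
  apply: eq_bigr => B BF; have [dimB _] := dim_fixed_block BF.
  have := card_vspaceF2 B; rewrite dimB -[8]/(2 ^ 3) => <-.
  rewrite -[#|B|]cardsE -[#|(B :&: _)%VS|]cardsE.
  rewrite -cardsDS; last by apply/subsetP=> x; rewrite !inE memv_cap => /andP[].
  congr #|pred_of_set _|; apply/setP=> x; rewrite !inE memv_cap.
  by case: (x \in B); rewrite ?andbF ?andbT.
move=> x; rewrite !inE mem_fixed_space => xNfix.
have x0 : x != 0%R by apply: contraNneq xNfix => ->; rewrite mul0mx.
have xA0 : (x *m A != 0)%R.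
  by rewrite -(mul0mx _ A) (can_eq mulmx_involutionK).
have xxA : (x != x *m A)%R by rewrite eq_sym.
have [|B [[BF /andP[xB xAB]] B_uniq]] := fixed_block_of_pair x0 xA0 xxA.
  by move=> B xB xAB; rewrite mulmx_involutionK.
(* A fixed block containing [x] also contains [x *m A], so it is the block of that pair. *)
exists B; split=> // B' [B'F xB']; apply: B_uniq; split=> //.
rewrite xB'; move: B'F; rewrite inE => /andP[_ /eqP <-].
by rewrite mem_subspace_mulmx.
Qed.

Lemma card_fixed_line_pairs :
  (#|fixed_space| - 1) * (#|fixed_space| - 2) =
  \sum_(B in fixed_blocks)
     (#|(B :&: fixed_space)%VS| - 1) * (#|(B :&: fixed_space)%VS| - 2).
Proof.
rewrite -card_line_pairs.
rewrite (@card_double_count _ _ _ fixed_blocks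
  (fun B p => (p.1 \in B) && (p.2 \in B))).
  apply: eq_bigr => B _; rewrite -card_line_pairs.
  congr #|pred_of_set _|; apply/setP=> -[x y]; rewrite !inE !memv_cap /=.
  by case: (x \in B); case: (y \in B); rewrite /= ?andbF ?andbT.
move=> [x y]; rewrite inE /= !mem_fixed_space.
case/and5P=> /eqP xA x0 /eqP yA y0 xy.
by apply: fixed_block_of_pair => // B xB yB; rewrite xA yA.
Qed.

(* Both counts are sums over the fixed blocks [B] of a function of
   [g := #|B :&: fixed_space|], and [3 * (8 - g) = 2 * (g - 1) * (g - 2)]
   modulo 7 for the only possible values [g = 4] and [g = 8]. *)
Lemma fixed_space_congruence :
  3 * 2 ^ v + 3 * #|fixed_space| = 2 * #|fixed_space| ^ 2 + 4 %[mod 7].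
Proof.
have le_v : #|fixed_space| <= 2 ^ v.
  by rewrite (leq_trans (max_card _)) // card_mx card_ord mul1n.
have gt0 : 0 < #|fixed_space| by rewrite card_vspaceF2 expn_gt0.
have : 3 * (2 ^ v - #|fixed_space|) =
    2 * ((#|fixed_space| - 1) * (#|fixed_space| - 2)) %[mod 7].
  rewrite card_not_fixed card_fixed_line_pairs !big_distrr /=.
  rewrite -modn_summ -[RHS]modn_summ; congr (_ %% 7); apply: eq_bigr => B BF.
  by rewrite card_vspaceF2; have [_ [-> | ->]] := dim_fixed_block BF.
move: (#|fixed_space|) (2 ^ v) gt0 le_v => x X x_gt0 le_xX.
(* Adding [6 * x] clears the truncated subtractions; at [x = 1] the factor [x - 1] vanishes, so
   truncation in [x - 2] is harmless. *)
move/eqP; rewrite -(eqn_modDr (6 * x)) => /eqP.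
have -> : 3 * (X - x) + 6 * x = 3 * X + 3 * x by lia.
by have -> : 2 * ((x - 1) * (x - 2)) + 6 * x = 2 * x ^ 2 + 4 by nia.
Qed.

End Involution.
End Subspaces.

(** * Arithmetic modulo 7, where 2 has order 3 *)

Lemma pow2_mod7 m : 2 ^ m %% 7 = 2 ^ (m %% 3).
Proof.
rewrite {1}(divn_eq m 3) expnD [_ * 3]mulnC expnM -modnMml -modnXm.
rewrite -[(2 ^ 3) %% 7]/1 exp1n mul1n.
by move: (ltn_pmod m (isT : 0 < 3)); case: (m %% 3) => [|[|[|]]].
Qed.

(** Nine pairs of residues modulo 3 are checked: for [v] congruent to 1 only [v - s] congruent to 1
    survives, and for [v] congruent to 0 exactly that residue is excluded. *)
Lemma rank_residue v s : s <= v ->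
    3 * 2 ^ v + 3 * 2 ^ (v - s) = 2 * (2 ^ (v - s)) ^ 2 + 4 %[mod 7] ->
  (v %% 3 = 1 -> 3 %| s) /\ (v %% 3 = 0 -> s <> 2 %[mod 3]).
Proof.
move=> le_sv.
have -> X x : (3 * X + 3 * x) %% 7 = (3 * (X %% 7) + 3 * (x %% 7)) %% 7 by lia.
have -> x : (2 * x ^ 2 + 4) %% 7 = (2 * (x %% 7) ^ 2 + 4) %% 7.
  by rewrite -modnDml -modnMmr -modnXm modnMmr modnDml.
rewrite !pow2_mod7.
have : (v - s) %% 3 < 3 by rewrite ltn_mod.
have : v %% 3 < 3 by rewrite ltn_mod.
case ev: (v %% 3) => [|[|[|]]] // _;
  case em: ((v - s) %% 3) => [|[|[|]]] // _ //= _;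
  split=> //; lia.
Qed.

Theorem theorem2 (n : nat) (D : {set {vspace 'rV['F_2]_n.+1}})
    (A : {'GL_n.+1['F_2]}) :
  is_q_steiner_triple_system D ->
  is_automorphism D (GLval A) ->
  #[A]%g = 2 ->
  (n.+1 = 1 %[mod 6] ->
     exists s : nat,
       [/\ 1 <= s <= n.+1 %/ 2, 3 %| s &
           exists P : {'GL_n.+1['F_2]},
             GLval (A ^ P)%g = swap_block_mx n.+1 s]) /\
  (n.+1 = 3 %[mod 6] ->
     exists s : nat,
       [/\ 1 <= s <= n.+1 %/ 2, s <> 2 %[mod 3] &
           exists P : {'GL_n.+1['F_2]},
             GLval (A ^ P)%g = swap_block_mx n.+1 s]).
Proof.
move=> steinerD autD ordA.
have AA : (GLval A *m GLval A = 1%:M)%R.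
  have := congr1 GLval (expg_order A); rewrite ordA expgS expg1.
  by rewrite GL_MxE GL_1E.
have [s [le_s [Q Qu QA]]] := involution_normal_form AA.
have conjA : exists P : {'GL_n.+1['F_2]},
    GLval (A ^ P)%g = swap_block_mx n.+1 s.
  (* [A ^ P] means [P^-1 * A * P], so the conjugating element is the inverse of [Q]. *)
  exists (Sub (invmx Q) (etrans (unitmx_inv Q) Qu)).
  by rewrite /conjg !GL_MxE GL_VxE /= invmxK mulmxA QA mulmxK.
have rkA : \rank (GLval A - 1%:M)%R = s.
  have QN : (Q *m (GLval A - 1%:M) = (swap_block_mx n.+1 s - 1%:M) *m Q)%R.
    by rewrite mulmxBr mulmxBl QA mulmx1 mul1mx.
  rewrite -(rank_swap_block_mx le_s) -(mxrankMfree _ (B := Q)) ?row_free_unit //.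
  by rewrite -QN eqmxMfull ?row_full_unit.
(* Rank zero would make [A] the identity, whose order is 1. *)
have s_gt0 : 0 < s.
  rewrite lt0n; apply/eqP=> s0; move: rkA; rewrite s0 => /eqP.
  rewrite mxrank_eq0 subr_eq0 => /eqP A1; have : A = 1%g by apply/val_inj.
  by move=> A1'; move: ordA; rewrite A1' order1.
have := fixed_space_congruence AA steinerD autD.
rewrite card_vspaceF2 dim_fixed_space rkA => /rank_residue[|res1 res0].
  by rewrite (leq_trans le_s) // leq_div.
have s_bounds : 1 <= s <= n.+1 %/ 2 by rewrite s_gt0.
split=> v_mod; exists s; split=> //.
  by apply: res1; lia.
by apply: res0; lia.
Qed.
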